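(* Let $R$ and $S$ be finite power-associative rings with identity and let $\phi : R \to S$ be a surjective ring homomorphism. Then the following types of elements can always be lifted over $\phi$: (a) Idempotents: for every $s \in S$ with $s^2 = s$ there is $r \in R$ with $r^2 = r$ and $\phi(r) = s$. (b) Nilpotents: for every nilpotent $s \in S$ there is a nilpotent $r \in R$ with $\phi(r) = s$. (c) Unipotents: for every unipotent $s \in S$ there is a unipotent $r \in R$ with $\phi(r) = s$. (d) Roots of unity: for every root of unity $s \in S$ there is a root of unity $r \in R$ with $\phi(r) = s$.
   Context: Rings here are not assumed associative or commutative (multiplication is biadditive), but they have a two-sided identity $1$. A ring is power-associative if the subring generated by any single element is associative; powers $x^k$ ($k \ge 1$) are then well defined, e.g. by $x^1 = x$, $x^{k+1} = x^k x$. Every associative ring is power-associative. An element $x$ is nilpotent if $x^k = 0$ for some positive integer $k$; unipotent if $1 - x$ is nilpotent; a root of unity if $x^m = 1$ for some positive integer $m$. In (d), the lift is only required to be a root of unity of some order, not necessarily of the same order as the given element. The identity of $S$ is the image under $\phi$ of the identity of $R$. *)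

(* Defs.v *)
From HB Require Import structures.
From mathcomp Require Import all_boot all_algebra.

Set Implicit Arguments.
Unset Strict Implicit.
Unset Printing Implicit Defensive.

Import GRing.Theory.
Local Open Scope ring_scope.

(* Unital rings whose multiplication is biadditive but neither associative nor
   commutative in general; the zero ring is allowed.  The multiplicative
   structures of MathComp's monoid library are not used for the product,
   because on a finite Zmodule group_scope already denotes the additive
   group. *)
HB.mixin Record Zmodule_isNARing R of GRing.Zmodule R := {
  naone : R;
  namul : R -> R -> R;
  namul1l : left_id naone namul;
  namul1r : right_id naone namul;
  namulDl : left_distributive namul +%R;
  namulDr : right_distributive namul +%R
}.

#[short(type="naRingType")]
HB.structure Definition NARing := {R of Zmodule_isNARing R & GRing.Zmodule R}.

#[short(type="finNARingType")]
HB.structure Definition FinNARing := {R of NARing R & Finite R}.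

Arguments naone {s}.

Notation "1%:NA" := naone : ring_scope.
Notation "x ** y" := (namul x y)
  (at level 40, left associativity) : ring_scope.

HB.mixin Record isNARMorphism (R S : naRingType) (f : R -> S) := {
  narmorph1 : f 1%:NA = 1%:NA;
  narmorphM : {morph f : x y / x ** y}
}.

HB.structure Definition NARMorphism (R S : naRingType) :=
  {f of isNARMorphism R S f & @GRing.Additive R S f}.

Notation "{ 'narmorphism' R -> S }" := (NARMorphism.type R%type S%type)
  (at level 0, R at level 98, S at level 99,
   format "{ 'narmorphism'  R  ->  S }") : type_scope.

Section NARingDefs.

Variable R : naRingType.
Implicit Types (A : R -> Prop) (x y z : R).

Definition is_subring A : Prop :=
  [/\ A 1%:NA,
      forall x y, A x -> A y -> A (x - y) &
      forall x y, A x -> A y -> A (x ** y)].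

Definition gen_subring x : R -> Prop :=
  fun y => forall A, is_subring A -> A x -> A y.

Definition associative_on A : Prop :=
  forall x y z, A x -> A y -> A z -> x ** (y ** z) = (x ** y) ** z.

(* Left-normed powers; only the exponents k > 0 are used below. *)
Fixpoint napow x (k : nat) : R :=
  if k is k'.+1 then napow x k' ** x else 1%:NA.

Definition na_idempotent x : Prop := x ** x = x.

Definition na_nilpotent x : Prop := exists2 k, (0 < k)%N & napow x k = 0.

Definition na_unipotent x : Prop := na_nilpotent (1%:NA - x).

Definition na_root_of_unity x : Prop :=
  exists2 m, (0 < m)%N & napow x m = 1%:NA.

End NARingDefs.

Definition power_associative (R : naRingType) : Prop :=
  forall x : R, associative_on (gen_subring x).

(* Main.v *)
(* Let r be any lift of s.  By finiteness some power e = r^N with N > 0 is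
   idempotent, and power-associativity lets one compute with the powers of r as
   in a commutative ring.  If s is idempotent, e lifts s.  If s is nilpotent,
   then phi(e) = 0 and the component r - r e of r is a nilpotent lift of s.  If
   s is a root of unity, then phi(e) = 1 and r e + (1 - e) is a root of unity
   lifting s.  Unipotents reduce to nilpotents through x |-> 1 - x. *)
Require Import Defs.
From HB Require Import structures.
From mathcomp Require Import all_boot all_algebra.

Set Implicit Arguments.
Unset Strict Implicit.
Unset Printing Implicit Defensive.

Import GRing.Theory.
Local Open Scope ring_scope.

Section NARingTheory.

Variable R : naRingType.
Implicit Types x y z : R.

Lemma namulBl x y z : (x - y) ** z = x ** z - y ** z.
Proof. by apply: (addIr (y ** z)); rewrite -namulDl !subrK. Qed.

Lemma namulBr x y z : x ** (y - z) = x ** y - x ** z.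
Proof. by apply: (addIr (x ** z)); rewrite -namulDr !subrK. Qed.

Lemma namul0l x : 0 ** x = 0.
Proof. by rewrite -{1}(subrr x) namulBl subrr. Qed.

Lemma napow_gen_subring x n : gen_subring x (napow x n).
Proof.
move=> A [A1 _ AM] Ax; elim: n => [|n IHn] //=.
exact: AM.
Qed.

Hypothesis paR : power_associative R.

(** All powers of [x] lie in the subring it generates, so the last factor can be reassociated. Later
    computations use power-associativity only through this law. *)
Lemma napowD x m n : napow x (m + n) = napow x m ** napow x n.
Proof.
elim: n => [|n IHn]; first by rewrite addn0 namul1r.
rewrite addnS /= IHn (paR (x := x)) //; exact: napow_gen_subring.
Qed.

(** Multiplying the coincidence by further powers of [x] makes the power sequence periodic with
    period [d] from exponent [i] on. *)
Lemma napow_stable x i d n q :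
  napow x (i + d) = napow x i -> (i <= n)%N ->
  napow x (n + q * d) = napow x n.
Proof.
move=> xid le_in; elim: q => [|q IHq]; first by rewrite addn0.
rewrite mulSn addnCA addnC napowD IHq -napowD -(subnKC le_in) addnAC.
by rewrite !napowD -napowD xid.
Qed.

Section IdempotentPower.

Variables (x : R) (N : nat).
Hypothesis idN : napow x (N + N) = napow x N.

Lemma napow_idempM q : (0 < q)%N -> napow x (q * N) = napow x N.
Proof.
by case: q => // q _; rewrite mulSn (napow_stable (i := N)).
Qed.

Lemma napow_addNN n : napow x (n + N + N) = napow x (n + N).
Proof. by rewrite -addnA napowD idN -napowD. Qed.

(** With e = x^N, the base is x(1 - e) and 1 - e is idempotent, so the power is x^n (1 - e).
    Exponent 0 would give 1 instead of 1 - e. *)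
Lemma napow_nil_part n : (0 < n)%N ->
  napow (x - napow x N.+1) n = napow x n - napow x (n + N).
Proof.
case: n => // n _; elim: n => [|n IHn].
  by rewrite /= !namul1l.
have x1 : x = napow x 1 by rewrite /= namul1l.
rewrite -[LHS]/(napow _ n.+1 ** _) IHn {3}x1 namulBl !namulBr -!napowD.
(* Of the four terms, the last two have exponents n + 2 + N and n + 2 + 2N, so they cancel. *)
rewrite -(addn1 N) !addnA [(n.+1 + N + 1)%N]addnAC [(n.+1 + N + N + 1)%N]addnAC.
by rewrite [(n.+1 + N + 1)%N]addnAC napow_addNN addn1 subrr subr0.
Qed.

Lemma nilpotent_part : (0 < N)%N -> na_nilpotent (x - napow x N.+1).
Proof.
by move=> N_gt0; exists N => //; rewrite napow_nil_part // idN subrr.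
Qed.

(** Since e = x^N and f = 1 - e are orthogonal idempotents, powers of xe + f are taken
    componentwise: x^n e + f. *)
Lemma napow_unit_part n :
  napow (napow x N.+1 + (1%:NA - napow x N)) n
  = napow x (n + N) + (1%:NA - napow x N).
Proof.
elim: n => [|n IHn]; first by rewrite /= subrKC.
set f := 1%:NA - napow x N in IHn *.
have ab : napow x (n + N) ** napow x N.+1 = napow x (n.+1 + N).
  by rewrite -napowD addnS /= napow_addNN.
have af : napow x (n + N) ** f = 0.
  by rewrite namulBr namul1r -napowD napow_addNN subrr.
have fb : f ** napow x N.+1 = 0.
  by rewrite namulBl namul1l -napowD addnS /= idN subrr.
have ff : f ** f = f.
  by rewrite namulBr namul1r namulBl namul1l -napowD idN subrr subr0.
(* With [f] opaque, distributivity cannot split it, and the four products above suffice. *)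
clearbody f.
by rewrite -[LHS]/(napow _ n ** _) IHn namulDl !namulDr ab af fb ff addr0 add0r.
Qed.

Lemma root_of_unity_part : (0 < N)%N ->
  na_root_of_unity (napow x N.+1 + (1%:NA - napow x N)).
Proof. by move=> N_gt0; exists N => //; rewrite napow_unit_part idN subrKC. Qed.

End IdempotentPower.

Lemma napow_idem x n : na_idempotent x -> (0 < n)%N -> napow x n = x.
Proof.
case: n => // n xx _; elim: n => [|n IHn]; first exact: namul1l.
by rewrite /= -/(napow x n.+1) IHn.
Qed.

End NARingTheory.

Lemma ex_idempotent_power (R : finNARingType) (x : R) : power_associative R ->
  exists2 N, (0 < N)%N & napow x (N + N) = napow x N.
Proof.
move=> paR; pose f (i : 'I_#|R|.+1) := napow x i.
have /injectivePn[i [j ne_ij eq_f]] : ~~ injectiveb f.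
  apply/injectiveP => /leq_card; by rewrite card_ord ltnn.
wlog lt_ij : i j ne_ij eq_f / (i < j)%N.
  move=> wl; case: (ltngtP i j) => [|lt_ji|/val_inj eq_ij]; first exact: wl.
    by apply: (wl j i) => //; rewrite eq_sym.
  by rewrite eq_ij eqxx in ne_ij.
have d_gt0 : (0 < j - i)%N by rewrite subn_gt0.
(* A multiple of the period [j - i] that is at least [i]; the factor [i.+1] keeps it positive when
   [i] is 0. *)
exists (i.+1 * (j - i))%N; first by rewrite muln_gt0.
apply: (napow_stable paR (i := i)); first by rewrite subnKC // ltnW.
by rewrite (leq_trans (leqnSn i)) // leq_pmulr.
Qed.

Section Lifting.

Variables (R S : finNARingType).
Hypotheses (paR : power_associative R) (paS : power_associative S).
Variable phi : {narmorphism R -> S}.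

Lemma narmorph_napow x n : phi (napow x n) = napow (phi x) n.
Proof. by elim: n => [|n IHn]; rewrite ?narmorph1 //= narmorphM IHn. Qed.

Lemma lift_idempotent x : na_idempotent (phi x) ->
  exists2 r, na_idempotent r & phi r = phi x.
Proof.
move=> idx; have [N N_gt0 idN] := ex_idempotent_power x paR.
exists (napow x N); first by rewrite /na_idempotent -napowD.
by rewrite narmorph_napow napow_idem.
Qed.

Lemma lift_nilpotent x : na_nilpotent (phi x) ->
  exists2 r, na_nilpotent r & phi r = phi x.
Proof.
move=> [k k_gt0 xk0]; have [N N_gt0 idN] := ex_idempotent_power x paR.
exists (x - napow x N.+1); first exact: nilpotent_part.
(* Rewriting x^N as x^(kN) lets a factor (phi x)^k = 0 be split off its image, as N > 0. *)
have xN0 : phi (napow x N) = 0.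
  rewrite -(napow_idempM paR idN k_gt0) narmorph_napow.
  rewrite -(prednK N_gt0) mulnC mulSn napowD // xk0.
  exact: namul0l.
by rewrite raddfB /= narmorphM xN0 namul0l subr0.
Qed.

Lemma lift_root_of_unity x : na_root_of_unity (phi x) ->
  exists2 r, na_root_of_unity r & phi r = phi x.
Proof.
move=> [m m_gt0 xm1]; have [N N_gt0 idN] := ex_idempotent_power x paR.
exists (napow x N.+1 + (1%:NA - napow x N)); first exact: root_of_unity_part.
(* Likewise x^N = x^(mN), whose image is a product of factors (phi x)^m = 1. *)
have xN1 : phi (napow x N) = 1%:NA.
  rewrite -(napow_idempM paR idN m_gt0) narmorph_napow mulnC.
  elim: (N) => [|q IHq] //; by rewrite mulSn napowD // xm1 namul1l.
by rewrite raddfD raddfB /= narmorphM xN1 narmorph1 namul1l subrr addr0.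
Qed.

End Lifting.

Theorem theorem2p2 (R S : finNARingType)
    (paR : power_associative R) (paS : power_associative S)
    (phi : {narmorphism R -> S}) (phi_surj : forall s : S, exists r : R, phi r = s) :
  [/\ forall s : S, na_idempotent s -> exists2 r : R, na_idempotent r & phi r = s,
      forall s : S, na_nilpotent s -> exists2 r : R, na_nilpotent r & phi r = s,
      forall s : S, na_unipotent s -> exists2 r : R, na_unipotent r & phi r = s &
      forall s : S, na_root_of_unity s ->
        exists2 r : R, na_root_of_unity r & phi r = s].
Proof.
split=> s; have [x <-] := phi_surj s.
- exact: lift_idempotent.
- exact: lift_nilpotent.
- rewrite /na_unipotent -(narmorph1 (s := phi)) -raddfB => nil1x.
  have [t nil_t phi_t] := lift_nilpotent paR paS nil1x.
  exists (1%:NA - t); first by rewrite /na_unipotent subKr.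
  by rewrite raddfB /= phi_t raddfB subKr.
- exact: lift_root_of_unity.
Qed.
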